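(* There exists some universal constant $c>0$ such that for all positive integers $n,N,m$, every $\epsilon\in(0,1)$ and every $\theta\in\mathbb{R}^n\setminus\{0\}$, $$\mathbb{P}\Big(\Big|\log\|X\theta\| - \frac12\log\Big(\frac1m\sum_{i\le m}\|X_{i,N-1:1}\theta\|^2\Big)\Big|\;\ge\;\frac{\epsilon}{2(1-\epsilon)}\Big)\;\le\;2e^{-cn\epsilon^2}.$$
   Context: For integers $n, N, m$, let $X_{ij}$ ($1\le i\le m$, $1\le j\le N$) be i.i.d. random $n\times n$ real matrices, each with i.i.d. $\mathcal{N}(0, n^{-1})$ entries, and set $$X := \frac{1}{\sqrt m}\sum_{i=1}^m X_i, \qquad X_i := X_{iN}X_{i(N-1)}\cdots X_{i1}, \qquad X_{i,N-1:1} := X_{i(N-1)}\cdots X_{i1}$$ (with $X_{i,N-1:1}$ the identity matrix if $N=1$). $\|\cdot\|$ is the Euclidean norm. *)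

(* Defs.v *)
From mathcomp Require Import all_boot all_order all_algebra.
From mathcomp Require Import all_classical all_reals all_analysis.

Set Implicit Arguments.
Unset Strict Implicit.
Unset Printing Implicit Defensive.

Import Order.TTheory GRing.Theory Num.Theory.

Local Open Scope classical_set_scope.
Local Open Scope ring_scope.

(* The norm that MathComp-Analysis puts on matrices is the sup norm. *)
Definition enorm (R : realType) (n : nat) (v : 'cV[R]_n) : R :=
  Num.sqrt (\sum_(a < n) v a 0 ^+ 2).

(* Independence of a finite family of real random variables: the product rule
   over every subfamily. *)
Definition mutually_independent (d : measure_display) (T : measurableType d)
    (R : realType) (P : probability T R) (I : finType)
    (Y : I -> {RV P >-> R}) : Prop :=
  forall (J : {set I}) (B : I -> set R),
    (forall k, k \in J -> measurable (B k)) ->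
    P (\bigcap_(k in [set` J]) (Y k @^-1` B k)) =
    (\prod_(k in J) P (Y k @^-1` B k))%E.

(* The law N(0, sigma2); the second argument of normal_prob is the standard
   deviation, not the variance. *)
Definition gaussian_law (d : measure_display) (T : measurableType d)
    (R : realType) (P : probability T R) (sigma2 : R) (Y : {RV P >-> R}) : Prop :=
  forall B : set R, measurable B ->
    distribution P Y B = normal_prob 0 (Num.sqrt sigma2) B.

(* X i j a b is the (a, b) entry of the j-th matrix of the i-th product.
   Independent matrices with independent entries: all the entries, over all
   indices (i, j, a, b) at once, form one independent family. *)
Definition iid_gaussian_matrices (d : measure_display) (T : measurableType d)
    (R : realType) (P : probability T R) (m N n : nat)
    (X : 'I_m -> 'I_N -> 'I_n -> 'I_n -> {RV P >-> R}) : Prop :=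
  mutually_independent
    (fun k : 'I_m * 'I_N * 'I_n * 'I_n => X k.1.1.1 k.1.1.2 k.1.2 k.2) /\
  forall i j a b, gaussian_law n%:R^-1 (X i j a b).

(* With 0-based indices j, the product A_(k-1) *m ... *m A_1 *m A_0 of the first
   k matrices, latest factor on the left; the identity if k = 0. *)
Definition lprod (R : realType) (N n : nat) (A : 'I_N -> 'M[R]_n) (k : nat) :
    'M[R]_n :=
  \big[mulmx/1%:M]_(j <- rev (enum 'I_N) | (j < k)%N) A j.

Section Model.
Context (d : measure_display) (T : measurableType d) (R : realType)
  (P : probability T R) (m N n : nat)
  (X : 'I_m -> 'I_N -> 'I_n -> 'I_n -> {RV P >-> R}).

Definition factor (w : T) (i : 'I_m) (j : 'I_N) : 'M[R]_n :=
  \matrix_(a, b) X i j a b w.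

(* Xprod is X_i = X_iN ... X_i1; Xprod_pred is X_(i,N-1:1); Xsum is X. *)
Definition Xprod (w : T) (i : 'I_m) : 'M[R]_n := lprod (factor w i) N.

Definition Xprod_pred (w : T) (i : 'I_m) : 'M[R]_n := lprod (factor w i) N.-1.

Definition Xsum (w : T) : 'M[R]_n :=
  (Num.sqrt m%:R)^-1 *: \sum_(i < m) Xprod w i.

End Model.

(* Main.v *)
(* Conditionally on all the factors but the last ones X_(iN), each coordinate of
   X theta is a linear form in independent Gaussians, whose coefficients have
   sum of squares s = m^-1 * \sum_i |X_(i,N-1:1) theta|^2; hence
   n |X theta|^2 / s is a chi-square variable with n degrees of freedom.
   To avoid conditional laws, its moment generating function is computed by
   integrating out one Gaussian variable Y_k at a time: Y_k is independent of
   the sigma-algebra of all the other variables, and completing the square gives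
     E exp(t (q Y_k + s)^2) = D^(-1/2) exp(t s^2 / D),  D = 1 - 2 t v q^2,
   so that successive integrations telescope even if q and s are random.
   Chernoff bounds at t = +- n eps / 8, with 1/(1-x) <= exp(x + 2 x^2), give the
   constant 1/16, and t -> -oo shows that no partial product sends theta to 0,
   up to a null set. Finally exp(eps/(1-eps)) >= 1 + eps and
   exp(-eps/(1-eps)) <= 1 - eps turn the logarithms into ratios. *)
From HB Require Import structures.
Require Import Defs.
From mathcomp Require Import all_boot all_order all_algebra.
From mathcomp Require Import all_classical all_reals all_analysis.
From mathcomp Require Import measurable_realfun.
From mathcomp Require Import ring lra.

Set Implicit Arguments.
Unset Strict Implicit.
Unset Printing Implicit Defensive.

Import Order.TTheory GRing.Theory Num.Theory.

Local Open Scope classical_set_scope.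
Local Open Scope ring_scope.

(** * Gaussian integrals, and integration over independent variables *)

Lemma ge0_integral_normal_prob (R : realType) (m s : R) (f : R -> \bar R) :
  measurable_fun [set: R] f -> (forall x, (0 <= f x)%E) ->
  (\int[normal_prob m s]_x f x =
   \int[lebesgue_measure]_x (f x * (normal_pdf m s x)%:E))%E.
Proof.
move=> mf f0.
have dom := normal_prob_dominates m s.
have mpdf : measurable_fun [set: R] (fun x => (normal_pdf m s x)%:E).
  by apply/measurable_EFinP; exact: measurable_normal_pdf.
have iRN := Radon_Nikodym_SigmaFinite.f_integrable dom.
rewrite -(Radon_Nikodym_SigmaFinite.change_of_variables dom f0)//.
apply: ae_eq_integral => //.
- by apply: emeasurable_funM => //; exact: measurable_int iRN.
- exact: emeasurable_funM.
apply: ae_eqe_mul2l.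
(* The Radon-Nikodym derivative and [normal_pdf] agree almost everywhere, having the same integral
   over every measurable set. *)
apply: integral_ae_eq => // E _ mE.
by rewrite -Radon_Nikodym_SigmaFinite.f_integral.
Qed.

(** Completing the square in [z]: tilting a centred normal density by a quadratic exponential gives
    a constant times another normal density, of variance [sigma ^+ 2 / D]. Positivity of [D] keeps
    that variance positive. *)
Lemma normal_pdf_expR_sqr (R : realType) (sigma t v s z : R) :
  sigma != 0 -> 0 < 1 - 2 * t * sigma ^+ 2 * v ^+ 2 ->
  let D := 1 - 2 * t * sigma ^+ 2 * v ^+ 2 in
  expR (t * (z * v + s) ^+ 2) * normal_pdf 0 sigma z =
  (Num.sqrt D)^-1 * expR (t * s ^+ 2 / D) *
  normal_pdf (2 * t * sigma ^+ 2 * v * s / D) (sigma / Num.sqrt D) z.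
Proof.
move=> s0 D0 D; rewrite -/D in D0.
have sD0 : Num.sqrt D != 0 by rewrite gt_eqF// sqrtr_gt0.
have sD2 : Num.sqrt D ^+ 2 = D by rewrite sqr_sqrtr// ltW.
rewrite !normal_pdfE ?mulf_neq0 ?invr_neq0// /normal_peak /normal_fun.
rewrite [RHS]mulrACA [LHS]mulrCA -!expRD.
congr (_ * expR _).
  rewrite expr_div_n sD2.
  rewrite (_ : sigma ^+ 2 / D * pi *+ 2 = (sigma ^+ 2 * pi *+ 2) / D);
    last by ring.
  have pi2 : 0 <= sigma ^+ 2 * pi *+ 2.
    by apply: mulrn_wge0; rewrite mulr_ge0 ?sqr_ge0 ?pi_ge0.
  rewrite [in RHS](sqrtrM _ pi2) (sqrtrV (ltW D0)).
  by rewrite invfM invrK mulrCA mulVf ?mulr1.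
rewrite expr_div_n sD2 /D.
by field; rewrite s0/= gt_eqF.
Qed.

Lemma integral_normal_prob_expR_sqr (R : realType) (sigma t v s : R) :
  sigma != 0 -> 0 < 1 - 2 * t * sigma ^+ 2 * v ^+ 2 ->
  (\int[normal_prob 0 sigma]_z (expR (t * (z * v + s) ^+ 2))%:E =
   ((Num.sqrt (1 - 2 * t * sigma ^+ 2 * v ^+ 2))^-1 *
    expR (t * s ^+ 2 / (1 - 2 * t * sigma ^+ 2 * v ^+ 2)))%:E)%E.
Proof.
move=> s0 D0; rewrite ge0_integral_normal_prob//; last first.
  apply/measurable_EFinP; apply: measurableT_comp => //.
  apply: measurable_funM => //; apply: measurable_funX.
  by apply: measurable_funD => //; exact: measurable_funM.
under eq_integral do rewrite -EFinM (normal_pdf_expR_sqr _ _ s0 D0) EFinM.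
rewrite ge0_integralZl//.
- by rewrite integral_normal_pdf mule1.
- by apply/measurable_EFinP; exact: measurable_normal_pdf.
- by move=> z _; rewrite lee_fin normal_pdf_ge0.
Qed.

(** Independence makes the joint law of [W] and [Z] the product of their laws, as seen on
    rectangles; Tonelli then integrates [Z] first. This takes the place of conditioning on [W]. *)
Lemma ge0_integral_indep (d d1 d2 : measure_display) (T : measurableType d)
    (T1 : measurableType d1) (T2 : measurableType d2) (R : realType)
    (P : probability T R) (W : {RV P >-> T1}) (Z : {RV P >-> T2})
    (f : T1 * T2 -> \bar R) :
  (forall A B, measurable A -> measurable B ->
    P (W @^-1` A `&` Z @^-1` B) = (P (W @^-1` A) * P (Z @^-1` B))%E) ->
  measurable_fun [set: T1 * T2] f -> (forall x, (0 <= f x)%E) ->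
  (\int[P]_w f (W w, Z w) =
   \int[P]_w \int[distribution P Z]_z f (W w, z))%E.
Proof.
move=> indep mf f0.
have mWZ : measurable_fun [set: T] (fun w => (W w, Z w)).
  by apply: measurable_fun_pair; exact: measurable_funP.
pose WZ : {RV P >-> _} := HB.pack (fun w => (W w, Z w))
  (isMeasurableFun.Build _ _ _ _ _ mWZ).
have mF : measurable_fun [set: T1]
    (fun x => \int[distribution P Z]_z f (x, z))%E.
  exact: measurable_fun_fubini_tonelli_F.
have F0 x : (0 <= \int[distribution P Z]_z f (x, z))%E.
  exact: integral_ge0.
rewrite -(ge0_integral_distribution WZ mf f0).
rewrite -(ge0_integral_distribution W mF F0).
rewrite -[RHS](fubini_tonelli1 f mf f0).
apply: eq_measure_integral => A mA _; symmetry.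
apply: (@product_measure_unique _ _ _ _ _ (distribution P W) (distribution P Z)
  (distribution P WZ)); [exact: indep|exact: mA].
Qed.

(** A pi-system generating the sigma-algebra of the coordinates indexed by [J]. *)
Definition cylinders {T : Type} {R : realType} {K : finType} (Y : K -> T -> R)
    (J : {set K}) : set (set T) :=
  [set \bigcap_(j in [set` J]) (Y j @^-1` B j) |
   B in [set B : K -> set R | forall j, measurable (B j)]].

Lemma setI_closed_cylinders (T : Type) (R : realType) (K : finType)
    (Y : K -> T -> R) (J : {set K}) : setI_closed (cylinders Y J).
Proof.
move=> _ _ [A mA <-] [B mB <-]; exists (fun j => A j `&` B j).
  by move=> j; exact: measurableI.
by rewrite -bigcapI.
Qed.

(** * Independence of one coordinate from the sigma-algebra of others *)

Section sigma_algebra_of_coordinates.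
Context (d : measure_display) (T : measurableType d) (R : realType)
  (P : probability T R) (K : finType) (Y : K -> {RV P >-> R}).
Implicit Types (J : {set K}) (k : K).

Local Notation G J := (cylinders (fun j => Y j : T -> R) J).

Lemma cylinders_measurable J : G J `<=` measurable.
Proof.
move=> _ [B mB <-]; apply: fin_bigcap_measurable; first exact: finite_finset.
by move=> j _; rewrite -[X in measurable X]setTI; exact: measurable_funPT.
Qed.

Lemma measurable_sub_cylinders J : <<s G J >> `<=` measurable.
Proof.
apply: smallest_sub; last exact: cylinders_measurable.
exact: sigma_algebra_measurable.
Qed.

(** For fixed [B], both sides are finite measures in [A]. They agree on the pi-system of cylinders
    by the product rule, hence on the sigma-algebra it generates. *)
Lemma cylinders_indep J k (A : set T) (B : set R) :
  mutually_independent Y -> k \notin J -> <<s G J >> A -> measurable B ->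
  P (A `&` Y k @^-1` B) = (P A * P (Y k @^-1` B))%E.
Proof.
move=> indep kJ GA mB.
have mYB : measurable (Y k @^-1` B).
  by rewrite -[X in measurable X]setTI; exact: measurable_funPT.
have PB : P (Y k @^-1` B) \is a fin_num by exact: fin_num_measure.
pose r := NngNum (fine_ge0 (measure_ge0 P (Y k @^-1` B))).
rewrite -[RHS]muleC -(fineK PB).
apply: (@g_sigma_algebra_measure_unique _ _ _ _ (@cylinders_measurable J)
  (fun=> setT) _ _ (mrestr P mYB) (mscale r P)) => //.
- move=> _; exists (fun=> setT) => //.
  by rewrite bigcapT // => j; rewrite preimage_setT.
- by rewrite bigcup_const //; exists 0%N.
- exact: setI_closed_cylinders.
- move=> _ [C mC <-].
  transitivity (P (Y k @^-1` B) * P (\bigcap_(j in [set` J]) Y j @^-1` C j))%E;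
    last by rewrite -(fineK PB).
  (* [C'] puts [B] at the new index [k], so that the product rule over [k |: J] is the one over [J]
     with one more factor. *)
  rewrite (indep J C) //; pose C' j := if j == k then B else C j.
  have C'k : C' k = B by rewrite /C' eqxx.
  have C'J j : j \in J -> C' j = C j.
    by rewrite /C'; case: eqP => // ->; rewrite (negbTE kJ).
  have := indep (k |: J)%SET C'; rewrite big_setU1 //= C'k.
  under eq_bigr => j jJ do rewrite C'J //.
  move=> <-; last by move=> j _; rewrite /C'; case: ifP.
  congr (P _); apply/seteqP; split=> w.
    move=> [JCw Bw] j /=; rewrite in_setU1 => /orP[/eqP ->|jJ].
      by rewrite C'k.
    by rewrite C'J //; exact: JCw.
  move=> h; split; last by rewrite -C'k; apply: h; exact: setU11.
  by move=> j jJ; rewrite -(C'J j jJ); apply: h; exact: setU1r.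
- move=> _; change (P ([set: T] `&` Y k @^-1` B) < +oo)%E.
  by rewrite setTI ltey_eq PB.
Qed.

End sigma_algebra_of_coordinates.

(* Real numbers carry two copies of the Borel structure, with different
   displays: the one of [{RV P >-> R}] and the one of [normal_prob]. *)
Lemma ge0_integral_gaussian (d : measure_display) (T : measurableType d)
    (R : realType) (P : probability T R) (var : R) (Y : {RV P >-> R})
    (f : R -> \bar R) :
  gaussian_law var Y -> measurable_fun [set: R] f -> (forall x, (0 <= f x)%E) ->
  (\int[distribution P Y]_z f z = \int[normal_prob 0 (Num.sqrt var)]_z f z)%E.
Proof.
move=> Yg mf f0.
have mZ : measurable_fun [set: T] (Y : T -> measurableTypeR R).
  by move=> mT B mB; exact: (measurable_funPT Y).
pose Z : {RV P >-> measurableTypeR R} := HB.pack (Y : T -> measurableTypeR R)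
  (isMeasurableFun.Build _ _ _ _ _ mZ).
rewrite ge0_integral_distribution // -(ge0_integral_distribution Z) //.
by apply: eq_measure_integral => A mA _; exact: Yg.
Qed.

(** Expresses that [f] depends only on the coordinates other than [Y k]. *)
Definition measurable_off {d : measure_display} {T : measurableType d}
    {R : realType} {K : finType} (Y : K -> T -> R) (k : K) (f : T -> R) :
    Prop :=
  measurable_fun [set: g_sigma_algebraType (cylinders Y (~: [set k]))] f.

(** * Integrating out one Gaussian coordinate *)

Section gaussian_coordinates.
Context (d : measure_display) (T : measurableType d) (R : realType)
  (P : probability T R) (K : finType) (Y : K -> {RV P >-> R}) (var : R).
Hypotheses (Yindep : mutually_independent Y) (var_gt0 : 0 < var)
  (Ygauss : forall k, gaussian_law var (Y k)).

Local Notation off := (measurable_off (fun j => Y j : T -> R)).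

Lemma measurable_off_measurable k (f : T -> R) :
  off k f -> measurable_fun [set: T] f.
Proof.
move=> mf _ B mB; rewrite setTI.
apply: (@measurable_sub_cylinders _ _ _ _ _ Y (~: [set k])%SET).
by rewrite -[X in smallest _ _ X]setTI; exact: (mf measurableT B mB).
Qed.

Lemma measurable_off_coordinate j k : j != k -> off k (Y j).
Proof.
move=> jk _ B mB; rewrite setTI; apply: sub_sigma_algebra.
exists (fun i => if i == j then B else setT).
  by move=> i; case: ifP.
apply/seteqP; split=> w /=.
  by move=> /(_ j); rewrite eqxx; apply; rewrite /= !inE.
by move=> Bw i _; case: eqP => // ->.
Qed.

(** Once the other coordinates are frozen, [h], [t], [q] and [s] are constants and the
    one-dimensional Gaussian integral applies pointwise. *)
Lemma gaussian_coordinate_elim k (h t q s : T -> R) :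
  off k h -> off k t -> off k q -> off k s -> (forall w, 0 <= h w) ->
  (forall w, 0 < 1 - 2 * t w * var * q w ^+ 2) ->
  (\int[P]_w (h w * expR (t w * (Y k w * q w + s w) ^+ 2))%:E =
   \int[P]_w (h w * (Num.sqrt (1 - 2 * t w * var * q w ^+ 2))^-1 *
     expR (t w / (1 - 2 * t w * var * q w ^+ 2) * s w ^+ 2))%:E)%E.
Proof.
move=> mh mt mq ms h0 D0.
(* [T1] is [T] with the coarser sigma-algebra of the coordinates other than [k]; the identity map
   [W] into it carries all of them at once as a single random variable. *)
pose T1 :=
  g_sigma_algebraType (cylinders (fun j => Y j : T -> R) (~: [set k])%SET).
have mid : measurable_fun [set: T] (id : T -> T1).
  move=> _ A mA; rewrite setTI.
  exact: (@measurable_sub_cylinders _ _ _ _ _ Y _ A mA).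
pose W : {RV P >-> T1} := HB.pack (id : T -> T1)
  (isMeasurableFun.Build _ _ _ _ _ mid).
pose f (x : T1 * R) := (h x.1 * expR (t x.1 * (x.2 * q x.1 + s x.1) ^+ 2))%:E.
have mf : measurable_fun [set: T1 * R] f.
  have comp1 (g : T -> R) : off k g -> measurable_fun [set: T1 * R] (g \o fst).
    by move=> mg; exact: measurableT_comp mg measurable_fst.
  apply/measurable_EFinP; apply: measurable_funM; first exact: (comp1 h).
  apply: measurableT_comp => //; apply: measurable_funM; first exact: (comp1 t).
  apply: measurable_funX; apply: measurable_funD; last exact: (comp1 s).
  by apply: measurable_funM; [exact: measurable_snd|exact: (comp1 q)].
have f0 x : (0 <= f x)%E by rewrite lee_fin mulr_ge0 ?expR_ge0.
transitivity (\int[P]_w f (W w, Y k w))%E; first by [].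
rewrite ge0_integral_indep //; last first.
  move=> A B mA mB; apply: (cylinders_indep Yindep _ mA mB).
  by rewrite !inE eqxx.
apply: eq_integral => w _.
have sD : 0 < 1 - 2 * t w * Num.sqrt var ^+ 2 * q w ^+ 2.
  by rewrite sqr_sqrtr // ltW.
have s0 : Num.sqrt var != 0 by rewrite gt_eqF // sqrtr_gt0.
rewrite (ge0_integral_gaussian (Ygauss k)) //; last first.
  rewrite /f /=; apply/measurable_EFinP; apply: measurable_funM => //.
  apply: measurableT_comp => //; apply: measurable_funM => //.
  apply: measurable_funX; apply: measurable_funD => //.
  exact: measurable_funM.
rewrite /f /=; under eq_integral do rewrite EFinM.
rewrite ge0_integralZl //; last 2 first.
  apply/measurable_EFinP; apply: measurableT_comp => //.
  apply: measurable_funM => //; apply: measurable_funX.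
  by apply: measurable_funD => //; exact: measurable_funM.
  by rewrite lee_fin.
rewrite integral_normal_prob_expR_sqr // sqr_sqrtr ?ltW //.
rewrite -EFinM; congr (_%:E); rewrite mulrA; congr (_ * expR _).
by rewrite mulrAC.
Qed.

End gaussian_coordinates.

Lemma measurable_sum_seq (d : measure_display) (T : measurableType d)
    (R : realType) (I : eqType) (s : seq I) (h : I -> T -> R) :
  (forall i, i \in s -> measurable_fun [set: T] (h i)) ->
  measurable_fun [set: T] (fun w => \sum_(i <- s) h i w).
Proof.
elim: s => [|i s IHs] mh.
  by under eq_fun do rewrite big_nil; exact: measurable_cst.
under eq_fun do rewrite big_cons; apply: measurable_funD.
  by apply: mh; rewrite mem_head.
by apply: IHs => j js; apply: mh; rewrite in_cons js orbT.
Qed.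

Lemma measurable_inv_gt0 (d : measure_display) (T : measurableType d)
    (R : realType) (f : T -> R) :
  (forall w, 0 < f w) -> measurable_fun [set: T] f ->
  measurable_fun [set: T] (fun w => (f w)^-1).
Proof.
move=> f0 mf; rewrite (_ : (fun _ => _) = (@powR R ^~ (-1)) \o f).
  exact: measurableT_comp.
by apply/funext => w /=; rewrite powR_inv1 // ltW.
Qed.

Lemma measurable_sqrt_gt0 (d : measure_display) (T : measurableType d)
    (R : realType) (f : T -> R) :
  (forall w, 0 < f w) -> measurable_fun [set: T] f ->
  measurable_fun [set: T] (fun w => Num.sqrt (f w)).
Proof.
move=> f0 mf; rewrite (_ : (fun _ => _) = (@powR R ^~ 2^-1) \o f).
  exact: measurableT_comp.
by apply/funext => w /=; rewrite powR12_sqrt // ltW.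
Qed.

(** The algebra behind the telescoping: passing from [t] to [t / D] turns a product of successive
    factors into the single factor for the total sum of squares. *)
Lemma one_sub_factor (F : fieldType) (t v a b D : F) :
  D != 0 -> D = 1 - 2 * t * v * a ->
  1 - 2 * t * v * (a + b) = D * (1 - 2 * (t / D) * v * b).
Proof.
move=> D0 DE; have -> : D * (1 - 2 * (t / D) * v * b) = D - 2 * t * v * b.
  by field.
by rewrite DE; ring.
Qed.

(** * Linear forms in several Gaussian coordinates *)

Section gaussian_forms.
Context (d : measure_display) (T : measurableType d) (R : realType)
  (P : probability T R) (K : finType) (Y : K -> {RV P >-> R}) (var : R).
Hypotheses (Yindep : mutually_independent Y) (var_gt0 : 0 < var)
  (Ygauss : forall k, gaussian_law var (Y k)).

Local Notation off := (measurable_off (fun j => Y j : T -> R)).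

(** Induction on [l]: the head coordinate is integrated out with the rest of the form absorbed into
    [s], after which [h] and [t] become [h / sqrt D1] and [t / D1]. These depend on [w] through [q],
    hence the random [h] and [t] in the statement. *)
Lemma gaussian_form_elim (C : eqType) (e : C -> K) (l : seq C)
    (q : C -> T -> R) (h t s : T -> R) :
  uniq (map e l) ->
  {in l, forall c, [/\ off (e c) h, off (e c) t, off (e c) s &
    forall c', off (e c) (q c')]} ->
  (forall w, 0 <= h w) ->
  (forall w, 0 < 1 - 2 * t w * var * \sum_(c <- l) q c w ^+ 2) ->
  (\int[P]_w (h w *
     expR (t w * (\sum_(c <- l) Y (e c) w * q c w + s w) ^+ 2))%:E =
   \int[P]_w (h w *
     (Num.sqrt (1 - 2 * t w * var * \sum_(c <- l) q c w ^+ 2))^-1 *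
     expR (t w / (1 - 2 * t w * var * \sum_(c <- l) q c w ^+ 2) *
           s w ^+ 2))%:E)%E.
Proof.
elim: l => [|c l IHl] /= in h t s *.
  move=> _ _ _ _; apply: eq_integral => w _.
  by rewrite !big_nil add0r mulr0 subr0 sqrtr1 invr1 !mulr1.
move=> /andP[cl ul] moff h0 D0.
pose D1 w := 1 - 2 * t w * var * q c w ^+ 2.
have Q0 w : 0 <= \sum_(c <- l) q c w ^+ 2.
  by apply: sumr_ge0 => i _; exact: sqr_ge0.
have D10 w : 0 < D1 w.
  have := D0 w; rewrite big_cons /D1 => D0w.
  (* For [t w >= 0], dropping squares from the sum only increases the expression; for [t w < 0] it
     is positive in any case. *)
  have [tw0|tw0] := leP 0 (t w).
    apply: (lt_le_trans D0w); rewrite lerB // ler_wpM2l //.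
      by rewrite !mulr_ge0 // ltW.
    by rewrite lerDl.
  rewrite subr_gt0 (@le_lt_trans _ _ 0) // -!mulrA pmulr_rle0 //.
  by rewrite mulr_le0_ge0 ?(ltW tw0) // mulr_ge0 ?sqr_ge0 // ltW.
have [mh mt ms mq] := moff c (mem_head _ _).
transitivity (\int[P]_w (h w * expR (t w * (Y (e c) w * q c w +
    (\sum_(c <- l) Y (e c) w * q c w + s w)) ^+ 2))%:E)%E.
  by apply: eq_integral => w _; rewrite big_cons addrA.
have ms' : off (e c) (fun w => \sum_(c <- l) Y (e c) w * q c w + s w).
  apply: measurable_funD => //; apply: measurable_sum_seq => c' c'l.
  have : off (e c) (Y (e c')).
    apply: measurable_off_coordinate.
    by apply: contraNneq cl => <-; exact: map_f.
  by move=> mY; exact: (measurable_funM mY (mq c')).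
rewrite (gaussian_coordinate_elim Yindep var_gt0 Ygauss mh mt (mq c) ms' h0
  D10).
rewrite (IHl (fun w => h w * (Num.sqrt (D1 w))^-1) (fun w => t w / D1 w) s ul).
- apply: eq_integral => w _; rewrite big_cons; congr (_%:E).
  set Q := \sum_(c <- l) _.
  have D1w := D10 w; have D1n : D1 w != 0 by rewrite gt_eqF.
  have DE : D1 w = 1 - 2 * t w * var * q c w ^+ 2 by [].
  rewrite (one_sub_factor Q D1n DE) sqrtrM ?ltW // !invfM !mulrA.
  by congr (_ * expR _).
- move=> c' c'l; have c'cl : c' \in c :: l by rewrite in_cons c'l orbT.
  have [mh' mt' {}ms' mq'] := moff c' c'cl.
  have mD1 : off (e c') D1.
    apply: measurable_funB; first exact: measurable_cst.
    apply: measurable_funM; last exact: (measurable_funX _ (mq' c)).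
    apply: measurable_funM; last exact: measurable_cst.
    by apply: measurable_funM; [exact: measurable_cst|exact: mt'].
  split => //.
    apply: (measurable_funM mh'); apply: measurable_inv_gt0.
      by move=> w; rewrite sqrtr_gt0.
    by apply: measurable_sqrt_gt0; [exact: D10|exact: mD1].
  apply: (measurable_funM mt'); apply: measurable_inv_gt0; first exact: D10.
  exact: mD1.
- by move=> w; rewrite mulr_ge0 // invr_ge0.
- move=> w; have := D0 w; rewrite big_cons.
  set Q := \sum_(c <- l) _.
  have D1w := D10 w; have D1n : D1 w != 0 by rewrite gt_eqF.
  have DE : D1 w = 1 - 2 * t w * var * q c w ^+ 2 by [].
  by rewrite (one_sub_factor Q D1n DE) pmulr_rgt0.
Qed.

End gaussian_forms.

(** Markov's inequality, from comparing the indicator of [A] with [f]. *)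
Lemma le_measure_integral (d : measure_display) (T : measurableType d)
    (R : realType) (P : {measure set T -> \bar R}) (A : set T) (f : T -> R) :
  measurable A -> measurable_fun [set: T] f -> (forall w, 0 <= f w) ->
  (forall w, A w -> 1 <= f w) -> (P A <= \int[P]_w (f w)%:E)%E.
Proof.
move=> mA mf f0 f1; rewrite -[A in P A]setIT -integral_indic //.
apply: ge0_le_integral => //.
- exact/measurable_EFinP/measurable_indic.
- exact/measurable_EFinP.
- move=> w _; rewrite lee_fin indicE.
  by have [/set_mem /f1|_] := boolP (w \in A).
Qed.

(** After squaring, [expR y >= 1 + y] reduces the claim to [(1 + x + 2 x^2) (1 - x) >= 1], where the
    excess is [x^2 (1 - 2 x)]. *)
Lemma inv_sqrt_1subr_le (R : realType) (x : R) : `|x| <= 2^-1 ->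
  (Num.sqrt (1 - x))^-1 <= expR ((x + 2 * x ^+ 2) / 2).
Proof.
rewrite ler_norml => /andP[x1 x2].
have x0 : 0 < 1 - x by lra.
have sx0 : 0 < Num.sqrt (1 - x) by rewrite sqrtr_gt0.
rewrite -[leLHS]mul1r ler_pdivrMr //.
rewrite -(@ler_pXn2r _ 2) // ?nnegrE ?mulr_ge0 ?expR_ge0 ?sqrtr_ge0 //.
rewrite expr1n exprMn (sqr_sqrtr (ltW x0)) -expRM_natl.
rewrite (_ : 2%:R * _ = x + 2 * x ^+ 2); last by field.
have := expR_ge1Dx (x + 2 * x ^+ 2).
move=> /(ler_wpM2r (ltW x0)); apply: le_trans.
rewrite -subr_ge0 (_ : _ - 1 = x ^+ 2 * (1 - 2 * x)); last by ring.
by rewrite mulr_ge0 ?sqr_ge0 //; lra.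
Qed.

(** * Chi-square variables: moment generating function, tails, no atom at zero *)

Section chi_square.
Context (d : measure_display) (T : measurableType d) (R : realType)
  (P : probability T R) (K : finType) (Y : K -> {RV P >-> R}) (n : nat).
Hypotheses (Yindep : mutually_independent Y) (n_gt0 : (0 < n)%N)
  (Ygauss : forall k, gaussian_law n%:R^-1 (Y k)).

Local Notation off := (measurable_off (fun j => Y j : T -> R)).

Context (C : finType) (e : 'I_n -> C -> K) (q : C -> T -> R).
Hypotheses (e_inj : injective (fun p : 'I_n * C => e p.1 p.2))
  (qoff : forall a c c', off (e a c) (q c'))
  (q1 : forall w, \sum_c q c w ^+ 2 = 1).

(** A chi-square variable with [n] degrees of freedom, divided by [n]: the coefficients form a unit
    vector and the coordinates have variance [1/n]. *)
Let chi w := \sum_(a < n) (\sum_c Y (e a c) w * q c w) ^+ 2.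

Let n_gt0R : 0 < n%:R^-1 :> R. Proof. by rewrite invr_gt0 ltr0n. Qed.

Let measurable_row a :
  measurable_fun [set: T] (fun w => (\sum_c Y (e a c) w * q c w) ^+ 2).
Proof.
apply: measurable_funX; apply: measurable_sum => c.
apply: measurable_funM; first exact: measurable_funPT.
by apply: (measurable_off_measurable (Y := Y) (k := e a c)); exact: qoff.
Qed.

Lemma measurable_chi_square : measurable_fun [set: T] chi.
Proof. exact: measurable_sum. Qed.

(** Rows are integrated out one by one, the remaining rows being put into [h]; injectivity of [e]
    keeps them free of the current row. The unit norm of [q] makes every row contribute the same
    factor. *)
Lemma integral_expR_chi_square t : 0 < 1 - 2 * t * n%:R^-1 ->
  (\int[P]_w (expR (t * chi w))%:E =
   ((Num.sqrt (1 - 2 * t * n%:R^-1))^-1 ^+ n)%:E)%E.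
Proof.
move=> t1; rewrite /chi.
suff rows (r : seq 'I_n) : uniq r ->
    (\int[P]_w (expR (t * \sum_(a <- r) (\sum_c Y (e a c) w * q c w) ^+ 2))%:E =
     ((Num.sqrt (1 - 2 * t * n%:R^-1))^-1 ^+ size r)%:E)%E.
  rewrite rows ?index_enum_uniq //; congr ((_ ^+ _)%:E).
  by rewrite -sum1_size sum1_card card_ord.
elim: r => [|a r IHr] /=.
  move=> _; under eq_integral do rewrite big_nil mulr0 expR0.
  by rewrite integral_cst //= probability_setT mule1.
move=> /andP[ar ur].
pose h w := expR (t * \sum_(a <- r) (\sum_c Y (e a c) w * q c w) ^+ 2).
have hoff c : off (e a c) h.
  apply: measurableT_comp => //.
  apply: measurable_funM; first exact: measurable_cst.
  apply: measurable_sum_seq => a' a'r; apply: measurable_funX.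
  apply: measurable_sum => c'; apply: measurable_funM; last exact: qoff.
  have : off (e a c) (Y (e a' c')); last by [].
  apply: measurable_off_coordinate; apply: contraNneq ar => ea.
  by have [<- _] := @e_inj (a', c') (a, c) ea.
transitivity (\int[P]_w (h w * expR (cst t w *
    (\sum_(c <- index_enum C) Y (e a c) w * q c w + cst 0 w) ^+ 2))%:E)%E.
  by apply: eq_integral => w _; rewrite big_cons addr0 mulrDr addrC expRD.
rewrite (gaussian_form_elim Yindep n_gt0R Ygauss).
- transitivity (\int[P]_w
      (((Num.sqrt (1 - 2 * t * n%:R^-1))^-1)%:E * (h w)%:E))%E.
    apply: eq_integral => w _.
    by rewrite q1 expr0n mulr0 expR0 !mulr1 -EFinM mulrC.
  rewrite ge0_integralZl //.
  + by rewrite IHr // -EFinM exprS.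
  + apply/measurable_EFinP; apply: measurableT_comp => //.
    by apply: measurable_funM; [exact: measurable_cst|exact: measurable_sum].
  + by move=> w _; rewrite lee_fin expR_ge0.
- rewrite map_inj_uniq ?index_enum_uniq // => c c' ecc.
  by have [] := @e_inj (a, c) (a, c') ecc.
- by move=> c _; split; [exact: hoff|exact: measurable_cst|
    exact: measurable_cst|exact: qoff].
- by move=> w; exact: expR_ge0.
- by move=> w; rewrite q1 mulr1.
Qed.

(** A single Chernoff bound for both tails: the sign of [x] decides whether the event is
    [chi >= 1 + y] or [chi <= 1 + y]. *)
Lemma chi_square_tail x y : `|x| <= 2^-1 ->
  (P [set w | (x * (1 + y) <= x * chi w)%R] <=
   (expR (n%:R / 2 * (2 * x ^+ 2 - x * y)))%:E)%E.
Proof.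
move=> x2; have n0 : n%:R != 0 :> R by rewrite pnatr_eq0 -lt0n.
(* This exponent turns [1 - 2 t / n] into [1 - x]. *)
pose t : R := n%:R / 2 * x.
have tx : 2 * t * n%:R^-1 = x by rewrite /t; field.
have t1 : 0 < 1 - 2 * t * n%:R^-1.
  by rewrite tx; move: x2; rewrite ler_norml => /andP[_ x2]; lra.
pose b : R := n%:R / 2 * (x * (1 + y)).
have mtchi : measurable_fun [set: T] (fun w => t * chi w).
  apply: measurable_funM; first exact: measurable_cst.
  exact: measurable_chi_square.
pose f w := expR (- b) * expR (t * chi w).
have mexp : measurable_fun [set: T] (fun w => expR (t * chi w)).
  exact: measurableT_comp.
have mf : measurable_fun [set: T] f.
  by apply: measurable_funM; [exact: measurable_cst|exact: mexp].
apply: (le_trans (le_measure_integral P _ mf _ _)).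
- rewrite -[X in measurable X]setTI; apply: measurable_fun_le => //.
  apply: measurable_funM; first exact: measurable_cst.
  exact: measurable_chi_square.
- by move=> w; rewrite mulr_ge0 ?expR_ge0.
- move=> w /= h; rewrite /f -expRD -[leLHS]expR0 ler_expR addrC subr_ge0.
  by rewrite /b /t -[leRHS]mulrA ler_wpM2l // divr_ge0.
under eq_integral do rewrite EFinM.
rewrite ge0_integralZl //; last exact/measurable_EFinP.
rewrite integral_expR_chi_square // -EFinM lee_fin tx.
have -> : n%:R / 2 * (2 * x ^+ 2 - x * y) =
    - b + n%:R * ((x + 2 * x ^+ 2) / 2) by rewrite /b; field.
rewrite expRD ler_wpM2l ?expR_ge0 // expRM_natl lerXn2r //.
- by rewrite nnegrE invr_ge0 sqrtr_ge0.
- by rewrite nnegrE expR_ge0.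
- exact: inv_sqrt_1subr_le.
Qed.

(** On the event [chi = 0] the exponential is 1 for every [t], while its expectation tends to 0 as
    [t] goes to minus infinity. *)
Lemma chi_square_eq0_null : P [set w | chi w = 0] = 0%E.
Proof.
have m0 : measurable [set w | chi w = 0].
  rewrite -[X in measurable X]setTI.
  exact: (measurable_chi_square measurableT (measurable_set1 0)).
apply/eqP; rewrite eq_le measure_ge0 andbT leNgt; apply/negP => p0.
set p := P _ in p0; have pfin : p \is a fin_num by exact: fin_num_measure.
have n0 : n%:R != 0 :> R by rewrite pnatr_eq0 -lt0n.
have {}p0 : 0 < fine p by rewrite fine_gt0 // p0 ltey_eq pfin.
(* With [x = p^-2], [(1 + x)^(-1/2) < p], and the [n]-th power is smaller still since [n >= 1]: a
   contradiction. *)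
pose x := (fine p) ^- 2; have x0 : 0 < x by rewrite invr_gt0 exprn_gt0.
pose t : R := - (n%:R / 2 * x).
have tx : 1 - 2 * t * n%:R^-1 = 1 + x by rewrite /t; field.
have t1 : 0 < 1 - 2 * t * n%:R^-1 by rewrite tx addr_gt0.
have : (p <= \int[P]_w (expR (t * chi w))%:E)%E.
  apply: le_measure_integral => //.
    apply: measurableT_comp => //.
    apply: measurable_funM; first exact: measurable_cst.
  exact: measurable_chi_square.
  by move=> w /= ->; rewrite mulr0 expR0.
rewrite integral_expR_chi_square // tx -(fineK pfin) lee_fin.
have sx : 1 <= Num.sqrt (1 + x).
  by rewrite -[leLHS]sqrtr1 ler_wsqrtr // lerDl ltW.
have sx0 : 0 < Num.sqrt (1 + x) by rewrite (lt_le_trans ltr01).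
apply/negP; rewrite -ltNge; apply: (@le_lt_trans _ _ (Num.sqrt (1 + x))^-1).
  rewrite -[leRHS]expr1 ler_wiXn2l ?invr_ge0 ?(ltW sx0) //.
  by rewrite invf_le1.
rewrite -[ltRHS]invrK ltf_pV2 ?posrE ?invr_gt0 //.
rewrite -(@ltr_pXn2r _ 2) ?nnegrE ?invr_ge0 ?(ltW sx0) ?(ltW p0) //.
by rewrite sqr_sqrtr ?addr_ge0 ?(ltW x0) // exprVn ltrDr.
Qed.

End chi_square.

(** * Random coefficient vectors, possibly zero, reduced to unit vectors *)

Section random_coefficients.
Context (d : measure_display) (T : measurableType d) (R : realType)
  (P : probability T R) (K : finType) (Y : K -> {RV P >-> R}) (n : nat).
Hypotheses (Yindep : mutually_independent Y) (n_gt0 : (0 < n)%N)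
  (Ygauss : forall k, gaussian_law n%:R^-1 (Y k)).

Local Notation off := (measurable_off (fun j => Y j : T -> R)).

Context (C : finType) (c0 : C) (e : 'I_n -> C -> K) (u : C -> T -> R).
Hypotheses (e_inj : injective (fun p : 'I_n * C => e p.1 p.2))
  (uoff : forall a c c', off (e a c) (u c')).

Let S w := \sum_c u c w ^+ 2.
Let V w := \sum_(a < n) (\sum_c Y (e a c) w * u c w) ^+ 2.

Let r w := S w `^ (- 2^-1).
(** The indicator of [S w = 0], in a form whose measurability follows from that of [S] and [r]. *)
Let z w := 1 - S w * r w ^+ 2.
(* [q] is [u] normalised, and the basis vector [c0] where [u] vanishes. *)
Let q c w := u c w * r w + z w * (c == c0)%:R.

Let S_ge0 w : 0 <= S w. Proof. by apply: sumr_ge0 => c _; exact: sqr_ge0. Qed.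

Let r2 w : S w != 0 -> r w ^+ 2 = (S w)^-1.
Proof.
move=> S0; rewrite /r powRN powR12_sqrt // exprVn sqr_sqrtr //.
Qed.

Let z0 w : S w != 0 -> z w = 0.
Proof. by move=> S0; rewrite /z r2 // mulfV // subrr. Qed.

Let q_unit w : \sum_c q c w ^+ 2 = 1.
Proof.
have [S0|S0] := eqVneq (S w) 0.
  have uw c : u c w = 0.
    move/eqP: S0; rewrite psumr_eq0; last by move=> c' _; exact: sqr_ge0.
    by move=> /allP /(_ c (mem_index_enum _)); rewrite /= sqrf_eq0 => /eqP.
  rewrite (bigD1 c0) //= big1 /q ?uw /z ?S0 ?eqxx.
    by rewrite !mul0r subr0 mulr1 add0r addr0 expr1n.
  by move=> c /negbTE ->; rewrite uw mul0r mulr0 add0r expr0n.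
under eq_bigr do rewrite /q z0 // mul0r addr0 exprMn.
by rewrite -mulr_suml r2 // mulfV.
Qed.

Let qoff a c c' : off (e a c) (q c').
Proof.
have mS : off (e a c) S.
  by apply: measurable_sum => i; apply: measurable_funX; exact: uoff.
have mr : off (e a c) r.
  exact: (measurableT_comp (measurable_powR (- 2^-1)) mS).
apply: measurable_funD.
  by apply: measurable_funM; [exact: uoff|exact: mr].
apply: measurable_funM; last exact: measurable_cst.
apply: measurable_funB; first exact: measurable_cst.
by apply: measurable_funM; [exact: mS|exact: (measurable_funX 2 mr)].
Qed.

Let chi w := \sum_(a < n) (\sum_c Y (e a c) w * q c w) ^+ 2.

Let chiE w : S w != 0 -> chi w = V w / S w.
Proof.
move=> S0; rewrite /chi /V mulr_suml; apply: eq_bigr => a _.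
rewrite -r2 // -exprMn mulr_suml; congr (_ ^+ 2); apply: eq_bigr => c _.
by rewrite /q z0 // mul0r addr0 mulrA.
Qed.

Let a0 : 'I_n := Ordinal n_gt0.

Lemma measurable_coef_norm : measurable_fun [set: T] S.
Proof.
apply: measurable_sum => c; apply: measurable_funX.
by apply: (measurable_off_measurable (Y := Y) (k := e a0 c)); exact: uoff.
Qed.

Lemma measurable_image_norm : measurable_fun [set: T] V.
Proof.
apply: measurable_sum => a; apply: measurable_funX; apply: measurable_sum => c.
apply: measurable_funM; first exact: measurable_funPT.
by apply: (measurable_off_measurable (Y := Y) (k := e a c)); exact: uoff.
Qed.

Let measurable_S0 : measurable [set w | S w = 0].
Proof.
rewrite -[X in measurable X]setTI.
exact: (measurable_coef_norm measurableT (measurable_set1 0)).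
Qed.

Lemma measurable_image_tail (x y : R) :
  measurable [set w | S w != 0 /\ x * (1 + y) * S w <= x * V w].
Proof.
rewrite (_ : [set w | _] = (~` [set w | S w = 0]) `&`
    [set w | x * (1 + y) * S w <= x * V w]).
  apply: measurableI; first exact: measurableC.
  rewrite -[X in measurable X]setTI; apply: measurable_fun_le => //.
    apply: measurable_funM; first exact: measurable_cst.
    exact: measurable_coef_norm.
  apply: measurable_funM; first exact: measurable_cst.
  exact: measurable_image_norm.
by apply/seteqP; split=> w /= -[/eqP S0 h].
Qed.

(** Where [S] is nonzero, [chi] is [V / S], so the event lies inside a chi-square tail. *)
Lemma gaussian_image_tail (x y : R) : `|x| <= 2^-1 ->
  (P [set w | (S w != 0)%R /\ (x * (1 + y) * S w <= x * V w)%R] <=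
   (expR (n%:R / 2 * (2 * x ^+ 2 - x * y)))%:E)%E.
Proof.
move=> x2.
have := chi_square_tail Yindep n_gt0 Ygauss e_inj qoff q_unit y x2.
apply: le_trans; apply: le_measure; rewrite ?inE.
- exact: measurable_image_tail.
- rewrite -[X in measurable X]setTI; apply: measurable_fun_le => //.
  apply: measurable_funM; first exact: measurable_cst.
  exact: measurable_chi_square qoff.
- move=> w /= [S0 h]; rewrite -/(chi w) chiE // mulrA ler_pdivlMr //.
  by rewrite lt_neqAle eq_sym S0 S_ge0.
Qed.

Lemma gaussian_image_eq0_null : P [set w | S w != 0 /\ V w = 0] = 0%E.
Proof.
have := chi_square_eq0_null Yindep n_gt0 Ygauss e_inj qoff q_unit.
move=> chi0; apply/eqP; rewrite -measure_le0 -[leRHS]chi0.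
apply: le_measure; rewrite ?inE.
- rewrite (_ : [set w | _] = (~` [set w | S w = 0]) `&` (V @^-1` [set 0])).
    apply: measurableI; first exact: measurableC.
    rewrite -[X in measurable X]setTI.
    exact: (measurable_image_norm measurableT (measurable_set1 0)).
  by apply/seteqP; split=> w /= -[/eqP S0 h].
- rewrite -[X in measurable X]setTI.
  exact: (measurable_chi_square qoff measurableT (measurable_set1 0)).
- by move=> w /= [S0 h]; rewrite -/(chi w) chiE // h mul0r.
Qed.

End random_coefficients.

(** * From logarithms to ratios, and the recursion for matrix products *)

Lemma half_le_normlB_lne (R : realType) (d x s : R) :
  0 <= x -> 0 <= s -> (s = 0 -> x = 0) ->
  ((d / 2)%:E <= `| lne (Num.sqrt x)%:E - (2^-1)%:E * lne s%:E |)%E =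
  (expR d * s <= x) || (x <= expR (- d) * s).
Proof.
move=> x0 s0 sx0; have [s00|s_neq0] := eqVneq s 0.
  (* Here [x = s = 0]: the difference of two [-oo] has absolute value [+oo] by convention, and both
     sides hold. *)
  rewrite sx0 // s00 sqrtr0 !mulr0 lexx /= lexx.
  by rewrite mulrNy gtr0_sg ?invr_gt0 // mul1e leey.
have {s_neq0}s0 : 0 < s by rewrite lt_neqAle eq_sym s_neq0.
have [x00|x_neq0] := eqVneq x 0.
  rewrite x00 sqrtr0 (lne_EFin s0) /= lexx /= leey.
  by rewrite mulr_ge0 ?expR_ge0 ?(ltW s0) // orbT.
have {x_neq0}x0 : 0 < x by rewrite lt_neqAle eq_sym x_neq0.
rewrite !lne_EFin ?sqrtr_gt0 // -powR12_sqrt ?(ltW x0) // ln_powR.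
rewrite -EFinM -EFinB -mulrBr abse_EFin lee_fin normrM ger0_norm // mulrC.
rewrite ler_pM2l ?invr_gt0 //.
have xE : x = expR (ln x) by rewrite lnK // posrE.
have sE : s = expR (ln s) by rewrite lnK // posrE.
move: (ln x) (ln s) xE sE => a b -> ->.
rewrite -!expRD !ler_expR ler_normr opprB.
congr (_ || _); first by rewrite lerBrDr.
by rewrite lerBrDr [- d + b]addrC lerBrDr addrC.
Qed.

Lemma lprod0 (R : realType) (N n : nat) (A : 'I_N -> 'M[R]_n) :
  lprod A 0 = 1%:M.
Proof. by rewrite /lprod big_pred0. Qed.

(** The ordinals below [k.+1] are those below [k] followed by [k], and reversal puts the last one in
    front; the lists are compared through their values in [iota]. *)
Lemma lprodS (R : realType) (N n k : nat) (A : 'I_N -> 'M[R]_n)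
    (kN : (k < N)%N) :
  lprod A k.+1 = A (Ordinal kN) *m lprod A k.
Proof.
have enumS j : (j <= N)%N ->
    map val [seq i <- enum 'I_N | (val i < j)%N] = iota 0 j.
  move=> jN; rewrite -(filter_map val (fun i => i < j)%N) val_enum_ord.
  rewrite -(subnKC jN) iotaD filter_cat add0n.
  rewrite (eq_in_filter (a2 := predT)) ?filter_predT; last first.
    by move=> i; rewrite mem_iota add0n.
  rewrite (eq_in_filter (a2 := pred0)) ?filter_pred0 ?cats0 //.
  by move=> i; rewrite mem_iota => /andP[ji _]; rewrite /= ltnNge ji.
have filterS : [seq i <- enum 'I_N | (val i < k.+1)%N] =
    rcons [seq i <- enum 'I_N | (val i < k)%N] (Ordinal kN).
  apply: (inj_map val_inj); rewrite map_rcons !enumS // ?(ltnW kN) //.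
  by rewrite -[k.+1]addn1 iotaD cats1.
rewrite /lprod -big_filter filter_rev filterS rev_rcons big_cons.
by rewrite -filter_rev big_filter.
Qed.

(** * Partial products applied to [theta] *)

Section model.
Context (d : measure_display) (T : measurableType d) (R : realType)
  (P : probability T R) (m N n : nat)
  (X : 'I_m -> 'I_N -> 'I_n -> 'I_n -> {RV P >-> R}) (theta : 'cV[R]_n).
Hypotheses (n_gt0 : (0 < n)%N) (iidX : iid_gaussian_matrices X)
  (theta_neq0 : theta != 0).

Let Y (k : 'I_m * 'I_N * 'I_n * 'I_n) := X k.1.1.1 k.1.1.2 k.1.2 k.2.

Local Notation off := (measurable_off (fun j => Y j : T -> R)).

Let Yindep : mutually_independent Y. Proof. exact: iidX.1. Qed.

Let Ygauss k : gaussian_law n%:R^-1 (Y k). Proof. exact: iidX.2. Qed.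

Let u k i b w : R := (lprod (Defs.factor X w i) k *m theta) b 0.

Let uS k (kN : (k < N)%N) i a w :
  u k.+1 i a w = \sum_b X i (Ordinal kN) a b w * u k i b w.
Proof.
rewrite /u (lprodS _ kN) -mulmxA mxE; apply: eq_bigr => b _.
by rewrite /Defs.factor mxE.
Qed.

(** Only factors of 0-based index below [k] enter [u k], hence no entry of a factor of index
    [j >= k], in whichever product [i']. *)
Lemma measurable_off_partial_product (j : 'I_N) k i i' a b c : (k <= j)%N ->
  off (i', j, a, b) (u k i c).
Proof.
elim: k c => [|k IHk] c kj.
  rewrite (_ : u 0 i c = cst (theta c 0)); first exact: measurable_cst.
  by apply/funext => w; rewrite /u lprod0 mul1mx.
have kN : (k < N)%N := leq_trans kj (ltnW (ltn_ord j)).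
rewrite (_ : u k.+1 i c = fun w =>
    \sum_c' Y (i, Ordinal kN, c, c') w * u k i c' w); last first.
  by apply/funext => w; exact: uS.
apply: measurable_sum => c'; apply: measurable_funM; last exact: IHk (ltnW kj).
have : off (i', j, a, b) (Y (i, Ordinal kN, c, c')); last by [].
apply: measurable_off_coordinate; apply/eqP => -[_ jk _ _].
by move: kj; rewrite -jk /= ltnn.
Qed.

(** Induction from [theta != 0]: a fresh Gaussian factor almost surely does not send a nonzero
    vector to zero. *)
Lemma partial_product_eq0_null (i : 'I_m) k : (k < N)%N ->
  P [set w | \sum_b u k i b w ^+ 2 = 0] = 0%E.
Proof.
elim: k => [|k IHk] kN.
  rewrite (_ : [set w | _] = set0) ?measure0 //.
  apply/seteqP; split=> w //= /eqP.
  rewrite psumr_eq0; last by move=> b _; exact: sqr_ge0.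
  move=> /allP th0; move: theta_neq0; rewrite (_ : theta = 0) ?eqxx //.
  apply/matrixP => b c; rewrite ord1 mxE.
  have := th0 b (mem_index_enum _).
  by rewrite /= /u lprod0 mul1mx sqrf_eq0 => /eqP.
have kN' := ltnW kN.
pose e a b : 'I_m * 'I_N * 'I_n * 'I_n := (i, Ordinal kN', a, b).
have e_inj : injective (fun p : 'I_n * 'I_n => e p.1 p.2).
  by move=> [a b] [a' b'] [-> ->].
have uoff a c c' : off (e a c) (u k i c').
  exact: measurable_off_partial_product.
have mS := measurable_coef_norm n_gt0 uoff.
have mV := measurable_image_norm uoff.
have VE w : \sum_(a < n) (\sum_c Y (e a c) w * u k i c w) ^+ 2 =
    \sum_b u k.+1 i b w ^+ 2.
  by apply: eq_bigr => a _; rewrite (uS kN').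
have := gaussian_image_eq0_null Yindep n_gt0 Ygauss (Ordinal n_gt0) e_inj uoff.
move=> V0; have S0 := IHk kN'.
pose Z0 := [set w | \sum_b u k i b w ^+ 2 = 0].
pose Z1 := [set w | \sum_b u k.+1 i b w ^+ 2 = 0].
have mZ0 : measurable Z0.
  rewrite -[X in measurable X]setTI.
  exact: (mS measurableT _ (measurable_set1 0)).
have mZ1 : measurable Z1.
  rewrite /Z1; under eq_set do rewrite -VE.
  rewrite -[X in measurable X]setTI.
  exact: (mV measurableT _ (measurable_set1 0)).
apply/eqP; rewrite -measure_le0 -/Z1.
(* Vanishing at stage [k.+1] means vanishing already at stage [k], or a nonzero vector being sent to
   zero; both events are null. *)
have <- : (P Z0 + P (~` Z0 `&` Z1) = 0)%E.
  rewrite S0 add0e -[RHS]V0; congr (P _); apply/seteqP.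
  split=> w /= [/eqP s0 v0]; split => //; first by rewrite VE.
  by rewrite /Z1 /= -VE.
apply: le_trans (measureU2 _ _ _) => //; last first.
  by apply: measurableI => //; exact: measurableC.
apply: le_measure; rewrite ?inE //.
  by apply: measurableU => //; apply: measurableI => //; exact: measurableC.
move=> w /= v0; have [s0|s0] := eqVneq (\sum_b u k i b w ^+ 2) 0; first by left.
by right; split => //; apply/eqP.
Qed.

(** * The last factors and the tail bound for the logarithm *)

Context (eps : R).
Hypotheses (N_gt0 : (0 < N)%N) (m_gt0 : (0 < m)%N) (eps01 : 0 < eps < 1).

Let last_lt : (N.-1 < N)%N. Proof. by rewrite prednK. Qed.

(** The last factors of the [m] products, side by side, form one Gaussian matrix with [n] rows and
    [m * n] columns. It acts on the stacked vector [v] of all preceding products applied to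
    [theta]. *)
Let e (a : 'I_n) (c : 'I_m * 'I_n) : 'I_m * 'I_N * 'I_n * 'I_n :=
  (c.1, Ordinal last_lt, a, c.2).

Let v (c : 'I_m * 'I_n) w := u N.-1 c.1 c.2 w.
Let S w := \sum_c v c w ^+ 2.
Let V w := \sum_(a < n) (\sum_c Y (e a c) w * v c w) ^+ 2.

Let e_inj : injective (fun p : 'I_n * ('I_m * 'I_n) => e p.1 p.2).
Proof. by move=> [a [i b]] [a' [i' b']] [-> -> ->]. Qed.

Let voff a c c' : off (e a c) (v c').
Proof. exact: measurable_off_partial_product. Qed.

Let V0 w : S w = 0 -> V w = 0.
Proof.
move=> /eqP; rewrite psumr_eq0; last by move=> c _; exact: sqr_ge0.
move=> /allP v0; rewrite /V big1 // => a _; rewrite big1 ?expr0n // => c _.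
have := v0 c (mem_index_enum _); rewrite /= sqrf_eq0 => /eqP ->.
by rewrite mulr0.
Qed.

Let mR : 0 < m%:R^-1 :> R. Proof. by rewrite invr_gt0 ltr0n. Qed.

Let sqr_enorm (x : 'cV[R]_n) : enorm x ^+ 2 = \sum_a x a 0 ^+ 2.
Proof. by rewrite sqr_sqrtr // sumr_ge0 // => a _; exact: sqr_ge0. Qed.

Let SE w : \sum_(i < m) enorm (Xprod_pred X w i *m theta) ^+ 2 = S w.
Proof.
rewrite /S -(pair_bigA _ (fun i b => u N.-1 i b w ^+ 2)) /=.
by apply: eq_bigr => i _; rewrite sqr_enorm.
Qed.

Let VE w : enorm (Xsum X w *m theta) = Num.sqrt (m%:R^-1 * V w).
Proof.
rewrite /enorm; congr Num.sqrt; rewrite /V mulr_sumr; apply: eq_bigr => a _.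
rewrite /Xsum -scalemxAl mulmx_suml mxE exprMn exprVn sqr_sqrtr //.
congr (_ * _ ^+ 2); rewrite summxE.
rewrite -(pair_bigA _
  (fun i b => X i (Ordinal last_lt) a b w * u N.-1 i b w)) /=.
apply: eq_bigr => i _; rewrite -(uS last_lt) /u /Xprod.
by rewrite prednK.
Qed.

Let mS : measurable_fun [set: T] S.
Proof. exact: (measurable_coef_norm n_gt0 voff). Qed.

Let mZ : measurable [set w | S w = 0].
Proof.
rewrite -[X in measurable X]setTI.
exact: (mS measurableT (measurable_set1 0)).
Qed.

(** If the stacked vector vanishes, so does its block [i0], which is a null event. *)
Let S_eq0_null : P [set w | S w = 0] = 0%E.
Proof.
pose i0 : 'I_m := Ordinal m_gt0.
have := partial_product_eq0_null i0 last_lt.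
move=> S0; apply/eqP; rewrite -measure_le0 -[leRHS]S0.
apply: le_measure; rewrite ?inE.
- exact: mZ.
- rewrite -[X in measurable X]setTI.
  have uoff a c c' : off (e a (i0, c)) (u N.-1 i0 c').
    exact: measurable_off_partial_product.
  exact: (measurable_coef_norm n_gt0 uoff measurableT (measurable_set1 0)).
- move=> w /= /eqP; rewrite psumr_eq0; last by move=> c _; exact: sqr_ge0.
  move=> /allP v0; rewrite big1 // => b _.
  by have := v0 (i0, b) (mem_index_enum _); rewrite /= => /eqP.
Qed.

Lemma log_norm_tail :
  (P [set w | ((eps / (2 * (1 - eps)))%:E <=
         `| lne (enorm (Xsum X w *m theta))%:E
            - (2^-1)%:E *
              lne (m%:R^-1 *
                   \sum_(i < m) enorm (Xprod_pred X w i *m theta) ^+ 2)%:E |)%E]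
   <= (2 * expR (- (16^-1 * n%:R * eps ^+ 2)))%:E)%E.
Proof.
have [eps0 eps1] := andP eps01.
have S_ge0 w : 0 <= S w by apply: sumr_ge0 => c _; exact: sqr_ge0.
have V_ge0 w : 0 <= V w by apply: sumr_ge0 => c _; exact: sqr_ge0.
pose delta := eps / (1 - eps).
pose G1 := [set w | expR delta * S w <= V w].
pose G2 := [set w | V w <= expR (- delta) * S w].
(* The threshold is [delta / 2], and the common factor [1/m] cancels from the ratios. *)
rewrite (_ : [set w | _] = G1 `|` G2); last first.
  rewrite (_ : eps / _ = delta / 2); last first.
    by rewrite /delta; field; rewrite subr_eq0 eq_sym lt_eqF.
  apply/funext => w; rewrite /= SE VE half_le_normlB_lne.
  - rewrite mulrCA ler_pM2l // [expR (- _) * _]mulrCA ler_pM2l //.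
    by apply/propext; split=> [/orP|/orP].
  - by rewrite mulr_ge0 ?(ltW mR).
  - by rewrite mulr_ge0 ?(ltW mR).
  - by move=> /eqP; rewrite mulf_eq0 gt_eqF //= => /eqP /V0 ->; rewrite mulr0.
have mV : measurable_fun [set: T] V := measurable_image_norm voff.
have mG1 : measurable G1.
  rewrite -[X in measurable X]setTI; apply: measurable_fun_le => //.
  by apply: measurable_funM => //; exact: measurable_cst.
have mG2 : measurable G2.
  rewrite -[X in measurable X]setTI; apply: measurable_fun_le => //.
  by apply: measurable_funM => //; exact: measurable_cst.
(* For [s = 1] and [s = -1] these are the tails [V >= (1 + eps) S] and [V <= (1 - eps) S]. The
   parameter [x = s * (eps / 4)] minimises [2 x^2 - x y] at [y = s * eps]; the minimum
   [- eps^2 / 8], times [n / 2], gives the constant 1/16. *)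
pose A s := [set w | S w != 0 /\
  s * (eps / 4) * (1 + s * eps) * S w <= s * (eps / 4) * V w].
have mA s : measurable (A s) by exact: (measurable_image_tail n_gt0 voff).
pose Z := [set w | S w = 0].
have PA s : s ^+ 2 = 1 ->
    (P (A s) <= (expR (- (16^-1 * n%:R * eps ^+ 2)))%:E)%E.
  move=> s2.
  have s1 : `|s| = 1 by rewrite -[LHS]sqrtr_sqr s2 sqrtr1.
  have := gaussian_image_tail Yindep n_gt0 Ygauss
    (Ordinal m_gt0, Ordinal n_gt0) e_inj voff (x := s * (eps / 4)) (s * eps).
  rewrite normrM s1 mul1r ger0_norm ?divr_ge0 ?(ltW eps0) //.
  move=> /(_ _)/le_trans; apply; first by lra.
  rewrite lee_fin ler_expR (_ : _ * (_ - _) =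
    n%:R / 2 * (2 * (s ^+ 2 * (eps ^+ 2 / 16)) - s ^+ 2 * eps ^+ 2 / 4));
    last by field.
  by rewrite s2 le_eqVlt; apply/orP; left; apply/eqP; field.
have up : 1 + eps <= expR delta.
  apply: le_trans (expR_ge1Dx _).
  rewrite lerD2l /delta ler_pdivlMr ?subr_gt0 //.
  by rewrite mulrBr mulr1 gerBl mulr_ge0 // ltW.
(* Inverted, this is [expR delta >= 1 + delta], since [1 + delta] is exactly [1 / (1 - eps)]. *)
have down : expR (- delta) <= 1 - eps.
  rewrite expRN -[leRHS]invrK lef_pV2 ?posrE ?invr_gt0 ?subr_gt0 ?expR_gt0 //.
  apply: le_trans (expR_ge1Dx _); rewrite le_eqVlt; apply/orP; left; apply/eqP.
  by rewrite /delta; field; rewrite subr_eq0 eq_sym lt_eqF.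
have GA : G1 `|` G2 `<=` Z `|` (A 1 `|` A (-1)%R).
  move=> w Gw; have [S0|S0] := eqVneq (S w) 0; [by left|right].
  case: Gw => Gw; [left|right]; split=> //; rewrite -mulrA.
    rewrite !mul1r ler_pM2l ?divr_gt0 //; apply: le_trans Gw.
    exact: ler_wpM2r.
  rewrite !mulN1r !mulNr lerN2 ler_pM2l ?divr_gt0 //; apply: le_trans Gw _.
  exact: ler_wpM2r.
have mAA : measurable (A 1 `|` A (-1)).
  exact: measurableU.
pose AA := Z `|` (A 1 `|` A (-1)).
apply: (@le_trans _ _ (P AA)).
  by apply: le_measure; rewrite ?inE //; exact: measurableU.
have PAA : (P AA <= P Z + P (A 1%R `|` A (-1)%R))%E := measureU2 P mZ mAA.
have PZ : P Z = 0%E := S_eq0_null.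
apply: (le_trans PAA); rewrite PZ add0e.
have PA2 : (P (A 1%R `|` A (-1)%R) <= P (A 1%R) + P (A (-1)%R))%E :=
  measureU2 P (mA 1) (mA (-1)).
apply: (le_trans PA2).
rewrite mulr2n mulrDl mul1r EFinD; apply: leeD; apply: PA.
  by rewrite expr1n.
by rewrite sqrrN expr1n.
Qed.

End model.

Theorem corollary6 (R : realType) :
  exists c : R, 0 < c /\
    forall (d : measure_display) (T : measurableType d) (P : probability T R)
      (n N m : nat) (X : 'I_m -> 'I_N -> 'I_n -> 'I_n -> {RV P >-> R})
      (eps : R) (theta : 'cV[R]_n),
      (0 < n)%N -> (0 < N)%N -> (0 < m)%N ->
      iid_gaussian_matrices X ->
      0 < eps < 1 ->
      theta != 0 ->
      (P [set w | ((eps / (2 * (1 - eps)))%:E <=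
             `| lne (enorm (Xsum X w *m theta))%:E
                - (2^-1)%:E *
                  lne (m%:R^-1 *
                       \sum_(i < m) enorm (Xprod_pred X w i *m theta) ^+ 2)%:E |)%E]
       <= (2 * expR (- (c * n%:R * eps ^+ 2)))%:E)%E.
Proof.
exists 16^-1; split; first by rewrite invr_gt0.
move=> d T P n N m X eps theta n0 N0 m0 iid eps01 theta0.
exact: log_norm_tail.
Qed.
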